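(* Let $\overline{A}=(A_1,\dots,A_X)$, $\overline{B}=(B_1,\dots,B_Y)$ be cardinalities with spaces $\mathcal{A},\mathcal{B}$ and let $\vec P\in\mathcal{A}\otimes\mathcal{B}$. Then: (1) $\vec P$ is normalized if and only if $$(\tau_{\mathcal A}\otimes\tau_{\mathcal B})\vec P=1\quad\text{and}\quad(\overline{\sigma}_{\mathcal A}^{\,k}\otimes\tau_{\mathcal B})\vec P=(\tau_{\mathcal A}\otimes\overline{\sigma}_{\mathcal B}^{\,l})\vec P=(\overline{\sigma}_{\mathcal A}^{\,k}\otimes\overline{\sigma}_{\mathcal B}^{\,l})\vec P=0$$ for all $k\in\{1,\dots,X-1\}$, $l\in\{1,\dots,Y-1\}$. (2) If $\vec P$ is normalized, then $\vec P$ is nonsignaling from $\mathrm A$ to $\mathrm B$ if and only if $(\overline{\sigma}_{\mathcal A}^{\,k}\otimes\gamma_{\mathcal B}^{j|y})\vec P=0$ for all $k\in\{1,\dots,X-1\}$, $y\in\{1,\dots,Y\}$, $j\in\{1,\dots,B_y-1\}$. (3) If $\vec P$ is normalized, then $\vec P$ is nonsignaling from $\mathrm B$ to $\mathrm A$ if and only if $(\gamma_{\mathcal A}^{i|x}\otimes\overline{\sigma}_{\mathcal B}^{\,l})\vec P=0$ for all $x\in\{1,\dots,X\}$, $i\in\{1,\dots,A_x-1\}$, $l\in\{1,\dots,Y-1\}$.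
   Context: A cardinality $\overline{A}=(A_1,\dots,A_X)$ is a finite nonempty sequence of positive integers: a device has inputs $x\in\{1,\dots,X\}$ and, for input $x$, outputs $a\in\{1,\dots,A_x\}$. The associated space is $\mathcal{A}=\mathbb{R}^{\sum_x A_x}$ with standard basis $[a|x]$ and dual standard basis $[a|x]^*\in\mathcal{A}^*$; elements of $\mathcal{A}\otimes\mathcal{B}$ have coordinates $P(ab|xy)$. Linear forms on $\mathcal{A}$: $\sigma_{\mathcal A}^x=\sum_{a=1}^{A_x}[a|x]^*$; $\tau_{\mathcal A}=\frac1X\sum_{x=1}^X\sigma_{\mathcal A}^x$; $\overline{\sigma}_{\mathcal A}^{\,k}=\frac1X(\sigma_{\mathcal A}^k-\sigma_{\mathcal A}^X)$ for $k\in\{1,\dots,X-1\}$; $\gamma_{\mathcal A}^{i|x}=A_x[i|x]^*-\sum_{a=1}^{A_x}[a|x]^*$ for $x\in\{1,\dots,X\}$, $i\in\{1,\dots,A_x-1\}$. The forms on $\mathcal{B}$ are defined in the same way from $\overline{B}$. $\vec P\in\mathcal{A}\otimes\mathcal{B}$ is normalized if $\sum_{a,b}P(ab|xy)=1$ for all $x,y$. It is nonsignaling from $\mathrm A$ to $\mathrm B$ if $\sum_aP(ab|xy)=\sum_aP(ab|x'y)$ for all $b,x,x',y$, and nonsignaling from $\mathrm B$ to $\mathrm A$ if $\sum_bP(ab|xy)=\sum_bP(ab|xy')$ for all $a,x,y,y'$. *)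

(* Defs.v *)
From HB Require Import structures.
From mathcomp Require Import all_boot all_order all_algebra.
From mathcomp Require Import reals.

Set Implicit Arguments.
Unset Strict Implicit.
Unset Printing Implicit Defensive.

Import GRing.Theory.
Local Open Scope ring_scope.

(* Inputs and outputs are numbered from 0: the ordinal [x : 'I_(ninputs A)]
   is the input numbered [x.+1] in the one-based convention, and similarly for
   outputs. *)
Record cardinality := Cardinality {
  ninputs : nat;
  noutputs : 'I_ninputs -> nat;
  ninputs_gt0 : (0 < ninputs)%N;
  noutputs_gt0 : forall x, (0 < noutputs x)%N
}.

Lemma last_input_subproof (A : cardinality) : ((ninputs A).-1 < ninputs A)%N.
Proof. by rewrite ltn_predL ninputs_gt0. Qed.

Definition last_input (A : cardinality) : 'I_(ninputs A) :=
  Ordinal (last_input_subproof A).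

(* Index set of the standard basis: pairs (x, a) with a an output for x. *)
Definition event (A : cardinality) : finType :=
  {x : 'I_(ninputs A) & 'I_(noutputs x)}.

Definition ev (A : cardinality) (x : 'I_(ninputs A)) (a : 'I_(noutputs x)) :
  event A := existT (fun x => 'I_(noutputs x)) x a.

(* Both R^(sum_x A_x) and the tensor product of two such spaces are coordinate
   spaces R^I for a finite index type I. *)
Definition cspace (R : realType) (I : finType) : vectType R :=
  {ffun I -> R^o}.

Definition form (R : realType) (I : finType) : vectType R :=
  'Hom(cspace R I, R^o).

Definition space (R : realType) (A : cardinality) : vectType R :=
  cspace R (event A).

Definition tspace (R : realType) (A B : cardinality) : vectType R :=
  cspace R (event A * event B)%type.

Section CoordinateSpace.
Variables (R : realType) (I : finType).

Definition basis_vec (u : I) : cspace R I := [ffun v => (v == u)%:R].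

Definition coord_fun (u : I) (v : cspace R I) : R^o := v u.

Lemma coord_fun_is_linear (u : I) : linear (coord_fun u).
Proof. by move=> c v w; rewrite /coord_fun !ffunE. Qed.

HB.instance Definition _ (u : I) :=
  GRing.isLinear.Build R (cspace R I) R^o _ (coord_fun u)
    (coord_fun_is_linear u).

Definition dual_basis (u : I) : form R I := linfun (coord_fun u).

Lemma dual_basisE (u : I) (v : cspace R I) : dual_basis u v = v u.
Proof. by rewrite lfunE. Qed.

Lemma cspace_sum (v : cspace R I) : v = \sum_u v u *: basis_vec u.
Proof.
apply/ffunP => w; rewrite sum_ffunE (bigD1 w) //= big1 => [|u /negPf uw].
  by rewrite !ffunE eqxx addr0 [_ *: _]mulr1.
by rewrite !ffunE eq_sym uw [_ *: _]mulr0.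
Qed.

Lemma form_sum (f : form R I) (v : cspace R I) :
  f v = \sum_u v u * f (basis_vec u).
Proof.
by rewrite {1}(cspace_sum v) linear_sum; apply: eq_bigr => u _; rewrite linearZ.
Qed.

End CoordinateSpace.

Section Forms.
Variables (R : realType) (A : cardinality).
Local Notation X := (ninputs A).
Implicit Types x k : 'I_X.

Definition sigma x : form R (event A) :=
  \sum_(a < noutputs x) dual_basis R (ev a).

Definition tau : form R (event A) := X%:R^-1 *: \sum_(x < X) sigma x.

(* Defined for every input k, and used for k other than the last input. *)
Definition sigma_bar k : form R (event A) :=
  X%:R^-1 *: (sigma k - sigma (last_input A)).

(* Defined for every output i, and used for i other than the last output. *)
Definition gamma x (i : 'I_(noutputs x)) : form R (event A) :=
  (noutputs x)%:R *: dual_basis R (ev i)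
    - \sum_(a < noutputs x) dual_basis R (ev a).

End Forms.

Section Tensor.
Variables (R : realType) (A B : cardinality).

Definition tensor_vec (v : space R A) (w : space R B) : tspace R A B :=
  [ffun p => v p.1 * w p.2].

(* The tensor product of linear forms, given by its values on the basis
   vectors of the tensor product; [tensor_form_vec] is its characteristic
   property. *)
Definition tensor_form (f : form R (event A)) (g : form R (event B)) :
    form R (event A * event B)%type :=
  \sum_(u : event A) \sum_(v : event B)
    (f (basis_vec R u) * g (basis_vec R v)) *: dual_basis R (u, v).

Lemma tensor_formE f g (P : tspace R A B) :
  tensor_form f g P = \sum_(u : event A) \sum_(v : event B)
    f (basis_vec R u) * g (basis_vec R v) * P (u, v).
Proof.
rewrite sum_lfunE; apply: eq_bigr => u _.
rewrite sum_lfunE; apply: eq_bigr => v _.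
by rewrite scale_lfunE dual_basisE.
Qed.

Lemma tensor_form_vec f g (v : space R A) (w : space R B) :
  tensor_form f g (tensor_vec v w) = f v * g w.
Proof.
rewrite tensor_formE [f v]form_sum [g w]form_sum mulr_suml.
apply: eq_bigr => s _; rewrite mulr_sumr; apply: eq_bigr => t _.
by rewrite ffunE /= mulrC mulrACA.
Qed.

(* [prob P a b] is P(ab|xy), the inputs x and y being those of the types of the
   outputs a and b. *)
Definition prob (P : tspace R A B) (x : 'I_(ninputs A)) (y : 'I_(ninputs B))
    (a : 'I_(noutputs x)) (b : 'I_(noutputs y)) : R := P (ev a, ev b).

Definition normalized (P : tspace R A B) : Prop :=
  forall (x : 'I_(ninputs A)) (y : 'I_(ninputs B)),
    \sum_(a < noutputs x) \sum_(b < noutputs y) prob P a b = 1.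

Definition nonsignaling_AB (P : tspace R A B) : Prop :=
  forall (x x' : 'I_(ninputs A)) (y : 'I_(ninputs B)) (b : 'I_(noutputs y)),
    \sum_(a < noutputs x) prob P a b = \sum_(a < noutputs x') prob P a b.

Definition nonsignaling_BA (P : tspace R A B) : Prop :=
  forall (x : 'I_(ninputs A)) (a : 'I_(noutputs x)) (y y' : 'I_(ninputs B)),
    \sum_(b < noutputs y) prob P a b = \sum_(b < noutputs y') prob P a b.

End Tensor.

Arguments tau R A : clear implicits.
Arguments sigma R [A] x.
Arguments sigma_bar R [A] k.
Arguments gamma R [A x] i.

(* Main.v *)
(** A tensor product of forms f and g, evaluated at P, is g applied to the
    contraction of P against f, and symmetrically with f and g exchanged; each
    claim thus reduces to statements about a single space. There, tau and the
    sigma_bar k with k not the last input determine all sigma x, and, on vectors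
    with sigma x = 0, the gamma i with i not the last output determine all the
    coordinates for x. *)

Require Import Defs.
From mathcomp Require Import all_boot all_order all_algebra.
From mathcomp Require Import reals.

Set Implicit Arguments.
Unset Strict Implicit.
Unset Printing Implicit Defensive.

Import GRing.Theory.
Local Open Scope ring_scope.

(** * Forms on a single space *)

Section SingleSpace.
Variables (R : realType) (A : cardinality).
Implicit Types (v : Defs.space R A) (x k : 'I_(ninputs A)) (c : R).

Lemma sigmaE x v : sigma R x v = \sum_(a < noutputs x) v (ev a).
Proof. by rewrite sum_lfunE; apply: eq_bigr => a _; rewrite dual_basisE. Qed.

Lemma tauE v : tau R A v = (ninputs A)%:R^-1 * \sum_x sigma R x v.
Proof. by rewrite scale_lfunE sum_lfunE. Qed.

Lemma sigma_barE k v :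
  sigma_bar R k v
  = (ninputs A)%:R^-1 * (sigma R k v - sigma R (last_input A) v).
Proof. by rewrite scale_lfunE add_lfunE opp_lfunE. Qed.

Lemma gammaE x (i : 'I_(noutputs x)) v :
  gamma R i v = (noutputs x)%:R * v (ev i) - sigma R x v.
Proof. by rewrite add_lfunE opp_lfunE scale_lfunE dual_basisE. Qed.

Lemma ninputs_neq0 : (ninputs A)%:R != 0 :> R.
Proof. by rewrite Num.Theory.pnatr_eq0 -lt0n ninputs_gt0. Qed.

(** Since the number of inputs is nonzero in [R], [sigma_bar R k v = 0] compares [sigma R k v] with
    its value at the last input, and comparing every input with one fixed input suffices. *)
Lemma sigma_constP v :
  (forall x x', sigma R x v = sigma R x' v) <->
  (forall k, (k.+1 < ninputs A)%N -> sigma_bar R k v = 0).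
Proof.
split=> [sv k _|sv].
  by rewrite sigma_barE (sv k (last_input A)) subrr mulr0.
suff s_last x : sigma R x v = sigma R (last_input A) v.
  by move=> x x'; rewrite !s_last.
have [x_lt|x_ge] := ltnP x.+1 (ninputs A).
  move/eqP: (sv x x_lt); rewrite sigma_barE mulf_eq0 invr_eq0.
  by rewrite (negPf ninputs_neq0) subr_eq0 => /eqP.
(* Here [ninputs A <= x.+1], so [x] is itself the last input. *)
congr (sigma R _ v); apply: val_inj => /=.
by apply/eqP; rewrite eqn_leq -ltnS prednK ?ninputs_gt0 // ltn_ord -ltnS
  prednK ?ninputs_gt0.
Qed.

(** The [sigma_bar] make the values [sigma R x v] equal, and [tau], being their average, then gives
    the common value. *)
Lemma sigma_eqP v c :
  (forall x, sigma R x v = c) <->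
  tau R A v = c /\
  (forall k, (k.+1 < ninputs A)%N -> sigma_bar R k v = 0).
Proof.
have tauc d : (forall x, sigma R x v = d) -> tau R A v = d.
  move=> sv; rewrite tauE (eq_bigr (fun=> d)) => [|x _]; last exact: sv.
  by rewrite sumr_const card_ord -[d *+ _]mulr_natl mulKf // ninputs_neq0.
split=> [sv|[tv /sigma_constP sv] x].
  by split; [exact: tauc | apply/sigma_constP => x x'; rewrite !sv].
(* [tauc] is used with [d := sigma R x v]. *)
by rewrite -tv; apply/esym/tauc => x'; apply: sv.
Qed.

(** When [sigma R x v = 0], [gamma R i] is a nonzero multiple of the coordinate at [i]. Only the
    last output has no form, and its coordinate is minus the sum of the others. *)
Lemma gamma_eq0P x v : sigma R x v = 0 ->
  (forall i : 'I_(noutputs x), v (ev i) = 0) <->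
  (forall i : 'I_(noutputs x), (i.+1 < noutputs x)%N -> gamma R i v = 0).
Proof.
move=> sv0; split=> [v0 i _|g0 i]; first by rewrite gammaE sv0 v0 mulr0 subr0.
have v0 (j : 'I_(noutputs x)) : (j.+1 < noutputs x)%N -> v (ev j) = 0.
  move=> /g0/eqP; rewrite gammaE sv0 subr0 mulf_eq0 Num.Theory.pnatr_eq0 eqn0Ngt.
  by rewrite noutputs_gt0 => /eqP.
have [/v0//|i_ge] := ltnP i.+1 (noutputs x).
(* As [i] is the last output, any [j] different from it satisfies the bound of [v0]. *)
rewrite -sv0 sigmaE (bigD1 i) //= big1 ?addr0 // => j ji; apply: v0.
rewrite ltnNge; apply: contra ji => j_ge; apply/eqP/val_inj/eqP.
by rewrite -eqSS eqn_leq !(leq_trans (ltn_ord _)).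
Qed.

End SingleSpace.

(** * Contraction of a tensor against a form on one factor *)

Section Contraction.
Variables (R : realType) (A B : cardinality).
Implicit Types (f : Defs.form R (event A)) (g : Defs.form R (event B)).
Implicit Type P : tspace R A B.

Definition contract f P : Defs.space R B :=
  [ffun v => \sum_u f (basis_vec R u) * P (u, v)].

(** Exchanging the parties gives contraction on the second factor from [contract], and claim (3)
    from claim (2). *)
Definition swap P : tspace R B A := [ffun p => P (p.2, p.1)].

Lemma tensor_form_contract f g P : tensor_form f g P = g (contract f P).
Proof.
rewrite tensor_formE exchange_big [g _]form_sum; apply: eq_bigr => v _.
by rewrite ffunE mulr_suml; apply: eq_bigr => u _; rewrite mulrAC.
Qed.

End Contraction.

(** * Normalization and nonsignaling *)

Section TwoParties.
Variables (R : realType) (A B : cardinality) (P : tspace R A B).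

Lemma swap_tensor_form (f : Defs.form R (event A)) (g : Defs.form R (event B)) :
  tensor_form g f (swap P) = tensor_form f g P.
Proof.
rewrite !tensor_formE exchange_big; apply: eq_bigr => u _.
by apply: eq_bigr => v _; rewrite ffunE [f _ * _]mulrC.
Qed.

Lemma tensor_form_contractl (f : Defs.form R (event A)) (g : Defs.form R (event B)) :
  tensor_form f g P = f (contract g (swap P)).
Proof. by rewrite -swap_tensor_form tensor_form_contract. Qed.

Lemma tensor_sigma_dual x y (b : 'I_(noutputs y)) :
  tensor_form (sigma R x) (dual_basis R (ev b)) P =
  \sum_(a < noutputs x) prob P a b.
Proof.
rewrite tensor_form_contractl sigmaE; apply: eq_bigr => a _.
rewrite ffunE (bigD1 (ev b)) //= big1 => [|v /negPf vb].
  by rewrite dual_basisE !ffunE eqxx mul1r addr0.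
by rewrite dual_basisE ffunE eq_sym vb mul0r.
Qed.

Lemma tensor_sigma x y :
  tensor_form (sigma R x) (sigma R y) P =
  \sum_(a < noutputs x) \sum_(b < noutputs y) prob P a b.
Proof.
rewrite exchange_big tensor_form_contract sigmaE; apply: eq_bigr => b _.
by rewrite -tensor_sigma_dual tensor_form_contract dual_basisE.
Qed.

(** [sigma_eqP] on the side of [A], for each [y]. The side of [B] keeps [sigma R y]: the second half
    is then the hypothesis of [gamma_eq0P] in the nonsignaling claim. *)
Lemma normalizedP :
  normalized P <->
  (forall y, tensor_form (tau R A) (sigma R y) P = 1) /\
  (forall (k : 'I_(ninputs A)) y, (k.+1 < ninputs A)%N ->
     tensor_form (sigma_bar R k) (sigma R y) P = 0).
Proof.
split=> [nP|[t1 s0] x y].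
  have sP y : forall x, sigma R x (contract (sigma R y) (swap P)) = 1.
    by move=> x; rewrite -tensor_form_contractl tensor_sigma.
  split=> [y|k y kX]; rewrite tensor_form_contractl.
    by case/sigma_eqP: (sP y).
  by case/sigma_eqP: (sP y) => _; apply.
rewrite -tensor_sigma tensor_form_contractl; move: x; apply/sigma_eqP.
by split=> [|k kX]; rewrite -tensor_form_contractl ?t1 ?s0.
Qed.

Lemma normalized_forms :
  normalized P <->
  [/\ tensor_form (tau R A) (tau R B) P = 1,
      forall k : 'I_(ninputs A), (k.+1 < ninputs A)%N ->
        tensor_form (sigma_bar R k) (tau R B) P = 0,
      forall l : 'I_(ninputs B), (l.+1 < ninputs B)%N ->
        tensor_form (tau R A) (sigma_bar R l) P = 0
    & forall (k : 'I_(ninputs A)) (l : 'I_(ninputs B)),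
        (k.+1 < ninputs A)%N -> (l.+1 < ninputs B)%N ->
        tensor_form (sigma_bar R k) (sigma_bar R l) P = 0].
Proof.
(* [sigma_eqP] on the side of [B], to be used with [tau R A] and [c = 1], then with each
   [sigma_bar R k] and [c = 0]. *)
have formsP f c : (forall y, tensor_form f (sigma R y) P = c) <->
    tensor_form f (tau R B) P = c /\
    forall l : 'I_(ninputs B), (l.+1 < ninputs B)%N ->
      tensor_form f (sigma_bar R l) P = 0.
  rewrite tensor_form_contract; split=> [fc|[fc f0] y].
    have /sigma_eqP[-> f0] : forall y, sigma R y (contract f P) = c.
      by move=> y; rewrite -tensor_form_contract.
    by split=> // l lY; rewrite tensor_form_contract f0.
  rewrite tensor_form_contract; move: y; apply/sigma_eqP.
  by split=> // l lY; rewrite -tensor_form_contract f0.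
split=> [/normalizedP[/formsP[t1 t0] s0]|[t1 st0 ts0 ss0]].
  have sbar0 (k : 'I_(ninputs A)) (kX : (k.+1 < ninputs A)%N) :=
    (formsP (sigma_bar R k) 0).1 (fun y => s0 k y kX).
  by split=> // [k /sbar0[]|k l /sbar0[_ ss0] /ss0].
apply/normalizedP; split; first exact/formsP.
move=> k y kX; move: y; apply/formsP.
by split=> [|l lY]; [exact: st0 | exact: ss0].
Qed.

(** By [sigma_constP] for each [b], nonsignaling means that the contractions against the
    [sigma_bar R k] have zero coordinates. By normalization these coordinates sum to zero for each
    [y], so the [gamma] forms detect whether they vanish. *)
Lemma nonsignaling_AB_forms : normalized P ->
  nonsignaling_AB P <->
  forall (k : 'I_(ninputs A)) (y : 'I_(ninputs B)) (j : 'I_(noutputs y)),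
    (k.+1 < ninputs A)%N -> (j.+1 < noutputs y)%N ->
    tensor_form (sigma_bar R k) (gamma R j) P = 0.
Proof.
move=> /normalizedP[_ s0].
have gammaP (k : 'I_(ninputs A)) y (kX : (k.+1 < ninputs A)%N) :
    (forall b : 'I_(noutputs y), contract (sigma_bar R k) P (ev b) = 0) <->
    (forall j : 'I_(noutputs y), (j.+1 < noutputs y)%N ->
       gamma R j (contract (sigma_bar R k) P) = 0).
  by apply: gamma_eq0P; rewrite -tensor_form_contract s0.
(* Both sides are the value at [P] of [sigma_bar R k] tensored with the dual basis form of [ev b];
   this passes between fixing [k] and fixing [b]. *)
have dualE k y (b : 'I_(noutputs y)) : contract (sigma_bar R k) P (ev b) =
    sigma_bar R k (contract (dual_basis R (ev b)) (swap P)).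
  by rewrite -tensor_form_contractl tensor_form_contract dual_basisE.
split=> [ns k y j kX jB|g0 x x' y b].
  rewrite tensor_form_contract; move: j jB; apply/(gammaP _ _ kX) => b.
  rewrite dualE; move: k kX; apply/sigma_constP => x x'.
  by rewrite -!tensor_form_contractl !tensor_sigma_dual.
rewrite -!tensor_sigma_dual !tensor_form_contractl; move: x x'.
apply/sigma_constP => k kX; rewrite -dualE; move: b; apply/(gammaP _ _ kX).
by move=> j jB; rewrite -tensor_form_contract g0.
Qed.

Lemma swap_normalized : normalized (swap P) <-> normalized P.
Proof.
have swapE x y : \sum_(b < noutputs y) \sum_(a < noutputs x) prob (swap P) b a
    = \sum_(a < noutputs x) \sum_(b < noutputs y) prob P a b.
  rewrite exchange_big; apply: eq_bigr => a _.
  by apply: eq_bigr => b _; rewrite /prob ffunE.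
by split=> nP x y; [rewrite -swapE | rewrite swapE].
Qed.

Lemma swap_nonsignaling : nonsignaling_AB (swap P) <-> nonsignaling_BA P.
Proof.
have swapE x (a : 'I_(noutputs x)) y : \sum_(b < noutputs y) prob (swap P) b a
    = \sum_(b < noutputs y) prob P a b.
  by apply: eq_bigr => b _; rewrite /prob ffunE.
by split=> ns => [x a y y'|y y' x a]; [rewrite -!swapE | rewrite !swapE].
Qed.

End TwoParties.

Theorem proposition9 (R : realType) (A B : cardinality) (P : tspace R A B) :
  (normalized P <->
     [/\ tensor_form (tau R A) (tau R B) P = 1,
         forall k : 'I_(ninputs A), (k.+1 < ninputs A)%N ->
           tensor_form (sigma_bar R k) (tau R B) P = 0,
         forall l : 'I_(ninputs B), (l.+1 < ninputs B)%N ->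
           tensor_form (tau R A) (sigma_bar R l) P = 0
       & forall (k : 'I_(ninputs A)) (l : 'I_(ninputs B)),
           (k.+1 < ninputs A)%N -> (l.+1 < ninputs B)%N ->
           tensor_form (sigma_bar R k) (sigma_bar R l) P = 0])
  /\
  (normalized P ->
     (nonsignaling_AB P <->
        forall (k : 'I_(ninputs A)) (y : 'I_(ninputs B)) (j : 'I_(noutputs y)),
          (k.+1 < ninputs A)%N -> (j.+1 < noutputs y)%N ->
          tensor_form (sigma_bar R k) (gamma R j) P = 0))
  /\
  (normalized P ->
     (nonsignaling_BA P <->
        forall (x : 'I_(ninputs A)) (i : 'I_(noutputs x)) (l : 'I_(ninputs B)),
          (i.+1 < noutputs x)%N -> (l.+1 < ninputs B)%N ->
          tensor_form (gamma R i) (sigma_bar R l) P = 0)).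
Proof.
split; first exact: normalized_forms.
split=> nP; first exact: nonsignaling_AB_forms.
rewrite -swap_nonsignaling nonsignaling_AB_forms ?swap_normalized //.
split=> g0 => [x i l iA lB|l x i lB iA].
  by rewrite -swap_tensor_form g0.
by rewrite swap_tensor_form g0.
Qed.
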